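(* Let $m$ be an even positive integer and let $D_{2m}=\langle u,v : u^m=e=v^2,\ vu=u^{m-1}v\rangle$. If $S\subseteq D_{2m}\setminus\{e\}$ with $|S|=2m-2$, then $D_{2m}$ has an $S$-sequencing.
   Context: For a group $G$ with identity $e$ and a set $S\subseteq G\setminus\{e\}$ with $|S|=k$, an $S$-sequencing of $G$ is an ordering $(g_1,\dots,g_k)$ of the elements of $S$ (each used exactly once) such that the partial products $h_0=e$, $h_i=g_1g_2\cdots g_i$ ($1\le i\le k$) are pairwise distinct. *)

(* Defs.v *)
From mathcomp Require Import all_boot all_fingroup.
Set Implicit Arguments. Unset Strict Implicit. Unset Printing Implicit Defensive.
Local Open Scope group_scope.

Definition partial_products (gT : finGroupType) (s : seq gT) : seq gT :=
  [seq \prod_(x <- take i s) x | i <- iota 0 (size s).+1].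

Definition is_S_sequencing (gT : finGroupType) (S : {set gT}) (s : seq gT) : bool :=
  perm_eq s (enum S) && uniq (partial_products s).

Definition has_S_sequencing (gT : finGroupType) (S : {set gT}) : Prop :=
  exists s : seq gT, is_S_sequencing S s.

(* Main.v *)
Require Import Defs.
From mathcomp Require Import all_boot all_fingroup.
From mathcomp Require Import all_solvable zify.

(* A set S of 2m - 2 nontrivial elements omits exactly one nontrivial x. Suppose
   that the group is R-sequenceable: there is a closed walk through 2m - 1
   distinct elements whose consecutive quotients are all the nontrivial elements,
   each once. Removing the arc with quotient x and translating the remaining path
   so that it starts at 1 gives an S-sequencing. For m = 2k such a closed walk is
   explicit: it zigzags inside the rotations, alternates between rotations and
   reflections, zigzags inside the reflections, and finally jumps back. *)

Local Open Scope nat_scope.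

(* The pair (b, i) stands for u^i v^b. The cycle starts at u^k instead of 1, so
   that every exponent met along it lies in [0, 2k) and no reduction modulo 2k
   is needed. *)
Definition vertex (k t : nat) : bool * nat :=
  if odd t then
    if t < k - odd k then (false, k + t./2.+1)
    else (true, if t <= k.*2 - odd k then odd k + t./2 else t./2.+1)
  else
    if t <= k.*2 - odd k then (false, k - t./2)
    else if t < 3 * k - odd k then (false, 3 * k - odd k - t./2)
    else (true, k.*2 - t./2.+1).

(* In multiplicative notation the labels are, in this order, with r := k - odd k:
   u, u^-2, u^3, ..., u^-r; then u^i v for i <> k; then u^(r+1), u^-(r+2), ...,
   u^(2k-1); and u^k v, which closes the cycle. *)
Definition label (k t : nat) : bool * nat :=
  if t < k - odd k then (false, if odd t then k.*2 - t.+1 else t.+1)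
  else if t < 3 * k - odd k - 1 then
    (true, if t < k.*2 - odd k then t - (k - odd k) else t.+1 - (k - odd k))
  else if t < 4 * k - 2 then (false, if odd t then t.+2 - k.*2 else 4 * k - t.+2)
  else (true, k).

(** A left inverse of [vertex], found by solving each of its branches for [t]; it gives injectivity
    without comparing all pairs of branches. *)
Definition position (k : nat) (p : bool * nat) : nat :=
  let i := p.2 in
  if p.1 then
    if i.*2.+2 <= k + odd k then (k.*2 - i.+1).*2
    else if i <= k then (i - odd k).*2.+1
    else i.*2.-1
  else if i <= k then (k - i).*2
  else if i.*2 <= 3 * k - odd k then (i - k).*2.-1
  else (3 * k - odd k - i).*2.

Lemma vertexK k t : t < 4 * k - 1 -> position k (vertex k t) = t.
Proof.
(* Writing k = o + 2j with o <= 1, and splitting [t] likewise, makes halves and parities linear, so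
   [lia] settles every branch. The later case analyses use the same substitution. *)
have [o [j [oE o_le1 kE]]] :
    exists o j, [/\ odd k = o :> nat, o <= 1 & k = o + j.*2].
  by exists (odd k), k./2; rewrite leq_b1 odd_double_half.
rewrite /vertex oE; have := odd_double_half t.
case: (odd t); move: t./2 => c <- lt; do 2?[case: ifP => //= ?].
all: by rewrite /position /= {}oE; do 2?[case: ifP => //= ?]; lia.
Qed.

Lemma vertex_inj k t t' : t < 4 * k - 1 -> t' < 4 * k - 1 ->
  vertex k t = vertex k t' -> t = t'.
Proof. by move=> lt lt' eqv; rewrite -(vertexK _ _ lt) eqv vertexK. Qed.

Lemma vertex_bound k t : t < 4 * k - 1 -> (vertex k t).2 < k.*2.
Proof.
rewrite /vertex; move: (leq_b1 (odd k)) (odd_double_half k).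
move: (nat_of_bool _) (k./2) => o j o_le1 <-; have := odd_double_half t.
by case: (odd t); move: t./2 => c <- lt; do 2?[case: ifP => //= ?]; lia.
Qed.

Lemma label_inj k t t' : t < 4 * k - 1 -> t' < 4 * k - 1 ->
  label k t = label k t' -> t = t'.
Proof.
rewrite /label; move: (leq_b1 (odd k)) (odd_double_half k).
move: (nat_of_bool _) (k./2) => o j o_le1 <-.
have := odd_double_half t'; have := odd_double_half t.
case: (odd t); move: t./2 => c <-; case: (odd t'); move: t'./2 => c' <- lt lt';
  do 3?[case: ifP => //= ?]; do 3?[case: ifP => //= ?].
all: by move=> E; move: (congr1 fst E) (congr1 snd E) => /=; lia.
Qed.

Lemma label_bound k t : t < 4 * k - 1 -> (label k t).2 < k.*2.
Proof.
rewrite /label; move: (leq_b1 (odd k)) (odd_double_half k).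
move: (nat_of_bool _) (k./2) => o j o_le1 <-; have := odd_double_half t.
by case: (odd t); move: t./2 => c <- lt; do 3?[case: ifP => //= ?]; lia.
Qed.

Lemma label_neq0 k t : t < 4 * k - 1 -> label k t <> (false, 0).
Proof.
rewrite /label; move: (leq_b1 (odd k)) (odd_double_half k).
move: (nat_of_bool _) (k./2) => o j o_le1 <-; have := odd_double_half t.
by case: (odd t); move: t./2 => c <- lt; do 3?[case: ifP => //= ?]; case; lia.
Qed.

(** Since v u^i = u^-i v, a rotation applied on the right of a reflection lowers its exponent,
    whence [k.*2 - l.2]. As e < 4k, reduction modulo 2k subtracts 2k at most once. *)
Lemma vertex_step k t (a := vertex k t) (b := vertex k (t.+1 %% (4 * k - 1)))
    (l := label k t) (e := a.2 + (if a.1 then k.*2 - l.2 else l.2)) :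
  t < 4 * k - 1 ->
  b.1 = a.1 (+) l.1 /\ (e = b.2 \/ e = b.2 + k.*2).
Proof.
rewrite {}/b => lt.
(* Only the last step, t = 4k - 2, wraps around; it returns to the starting vertex u^k. *)
have -> : vertex k (t.+1 %% (4 * k - 1))
    = if t.+1 < 4 * k - 1 then vertex k t.+1 else (false, k).
  have [t1_lt|t1_ge] := ltnP; first by rewrite modn_small.
  have -> : t.+1 = 4 * k - 1 by lia.
  by rewrite modnn /vertex /= subn0.
rewrite {}/e {}/l {}/a /vertex /label /= uphalf_half.
move: (leq_b1 (odd k)) (odd_double_half k) lt.
move: (nat_of_bool _) (k./2) => o j o_le1 <-; have := odd_double_half t.
case: (odd t); move: t./2 => c <- lt /=.
all: by do !(case: ifP => //= ?; try by exfalso; lia); split=> //; lia.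
Qed.

Local Open Scope group_scope.

(** The products telescope; the factor [(h 0)^-1] is the translation that makes the path start at
    1. *)
Lemma partial_products_quotients (gT : finGroupType) (h : nat -> gT) n :
  partial_products [seq (h i)^-1 * h i.+1 | i <- iota 0 n]
  = [seq (h 0)^-1 * h i | i <- iota 0 n.+1].
Proof.
rewrite /partial_products size_map size_iota; apply/eq_in_map => i.
rewrite mem_iota /= add0n ltnS => le_i_n.
rewrite -map_take take_iota (minn_idPl le_i_n) big_map {le_i_n}.
elim: i => [|i IHi]; first by rewrite big_nil mulVg.
by rewrite -addn1 iotaD big_cat big_seq1 IHi /= add0n -mulgA mulKVg addn1.
Qed.

(** Indexing the cycle by all naturals, with injectivity modulo [N.+1], allows it to be cut at any
    arc by a mere shift of indices. *)
Lemma R_sequencing_has_S_sequencing (gT : finGroupType) (G : {group gT}) N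
    (h l : nat -> gT) (S : {set gT}) :
    #|G| = N.+2 ->
    (forall i, h i * l i = h i.+1) -> (forall i, l i \in G^#) ->
    (forall i j, h i = h j -> i = j %[mod N.+1]) ->
    (forall i j, l i = l j -> i = j %[mod N.+1]) ->
  S \subset G^# -> #|S| = N -> has_S_sequencing S.
Proof.
move=> oG hl lG h_inj l_inj sSG oS.
have modD j i i' :
    i < N.+1 -> i' < N.+1 -> j + i = j + i' %[mod N.+1] -> i = i'.
  by move=> lti lti' /eqP; rewrite eqn_modDl !modn_small // => /eqP.
have oG1 : #|G^#| = N.+1 by have := cardsD1 1 G; rewrite group1 oG => -[].
have /cards1P[x defx] : #|G^# :\: S| == 1%N.
  by rewrite cardsD (setIidPr sSG) oG1 oS subSn ?subnn.
have [j lj] : exists j, l j = x.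
  (* The [N.+1] distinct labels lie in a set of [N.+1] elements, so they exhaust it and [x] is among
     them. *)
  have /(uniq_min_size (s2 := enum G^#)) : uniq [seq l i | i <- iota 0 N.+1].
    rewrite map_inj_in_uniq ?iota_uniq // => i i'; rewrite !mem_iota => /= ? ?.
    by move/l_inj; apply: (@modD 0).
  case.
  - by move=> y /mapP[i _ ->]; rewrite mem_enum.
  - by rewrite size_map size_iota -cardE oG1.
  move=> _ eq_l; have: x \in G^# :\: S by rewrite defx set11.
  by case/setDP; rewrite -mem_enum -eq_l => /mapP[i _ ->]; exists i.
(* The path starts at the head of the arc labelled [x] and takes the [N] other arcs. *)
pose h' i := h (j.+1 + i); pose t := [seq (h' i)^-1 * h' i.+1 | i <- iota 0 N].
have tE : t = [seq l (j.+1 + i) | i <- iota 0 N].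
  by apply: eq_map => i; rewrite /h' addnS -hl mulKg.
exists t; rewrite /is_S_sequencing partial_products_quotients.
apply/andP; split; last first.
  rewrite map_inj_in_uniq ?iota_uniq // => i i'; rewrite !mem_iota => /= ? ?.
  by move=> /mulgI/h_inj; apply: modD.
have t_uniq : uniq t.
  rewrite tE map_inj_in_uniq ?iota_uniq // => i i'; rewrite !mem_iota => /= ? ?.
  by move=> /l_inj; apply: modD; lia.
have sub_t : {subset t <= enum S}.
  move=> y; rewrite tE => /mapP[i]; rewrite mem_iota add0n => /= ltiN ->.
  rewrite mem_enum; apply: contraTT (lG (j.+1 + i)) => notS.
  apply/negP=> liG; have: l (j.+1 + i) \in G^# :\: S by rewrite in_setD notS.
  (* A label equal to [l j] would force i + 1 = 0 modulo N + 1, which i < N excludes. *)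
  rewrite defx inE -lj => /eqP/l_inj; rewrite addSnnS -[in RHS](addn0 j).
  by move/modD => /(_ ltiN isT).
apply: uniq_perm => //; first exact: enum_uniq.
case: (uniq_min_size t_uniq sub_t) => //.
by rewrite -cardE oS tE size_map size_iota.
Qed.

(** The library's dihedral group satisfies the relations, so it is a homomorphic image of [G] and
    bounds its order below; the product of cyclic groups of orders at most m and 2 bounds it
    above. *)
Lemma dihedral_structure {gT : finGroupType} {G : {group gT}} {m : nat} :
  1 < m ->
  G \isog Grp (u : v : (u ^+ m = 1, v ^+ 2 = 1, v * u = u ^+ m.-1 * v)) ->
  exists u v : gT,
  [/\ #|G| = m.*2, [/\ u ^+ m = 1, v ^+ 2 = 1 & u ^ v = u^-1]
    & G = <[u]> * <[v]> :> {set gT}].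
Proof.
move=> m_gt1 isoG.
have invE (hT : finGroupType) (x : hT) : x ^+ m = 1 -> x ^+ m.-1 = x^-1.
  by move=> xm; apply: (mulgI x); rewrite mulgV -expgS prednK // ltnW.
have oD : #|'D_(m.*2)| = m.*2 by apply: card_dihedral.
have leG : m.*2 <= #|G|.
  rewrite -oD; apply/leq_homg; rewrite isoG.
  have /existsP[[x y] /=] := isoGrp_hom (Grp_dihedral m_gt1).
  rewrite !xpair_eqE => /and4P[/eqP defD /eqP xm /eqP y2 /eqP xy].
  apply/existsP; exists (x, y); rewrite /= !xpair_eqE defD xm y2 !eqxx /=.
  rewrite invE // -xy; apply/eqP.
  have yV : y^-1 = y by apply/(mulgI y); rewrite mulgV -expg2.
  by rewrite conjgE yV -!mulgA -expg2 y2 mulg1.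
have /existsP[[u v] /=] := isoGrp_hom isoG.
rewrite !xpair_eqE => /and4P[/eqP defG /eqP um /eqP v2 /eqP uv].
have uJv : u ^ v = u^-1.
  have vV : v^-1 = v by apply/(mulgI v); rewrite mulgV -expg2.
  by rewrite conjgE vV mulgA uv invE // -mulgA -expg2 v2 mulg1.
have {defG} GE : G = <[u]> * <[v]> :> {set gT}.
  rewrite -defG norm_joinEr // cycle_subG.
  by apply/normP; rewrite -cycleJ uJv cycleV.
exists u, v; split=> //; apply/eqP; rewrite eqn_leq leG andbT.
rewrite GE -muln2 (leq_trans (dvdn_leq _ (dvdn_cardMg _ _))) //.
  by rewrite muln_gt0 !cardG_gt0.
rewrite leq_mul //.
  by rewrite dvdn_leq ?order_dvdn ?um // ltnW.
by rewrite dvdn_leq ?order_dvdn ?v2.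
Qed.

Definition dihedral_elt {gT : finGroupType} (u v : gT) (p : bool * nat) : gT :=
  u ^+ p.2 * v ^+ p.1.

(** Any representative [a] modulo [m] is allowed, so the exponents given by [vertex] can serve as
    they stand. *)
Lemma dihedral_eltM {gT : finGroupType} (u v : gT) (m : nat) p l a :
    u ^+ m = 1 -> v ^+ 2 = 1 -> u ^ v = u^-1 -> (l.2 <= m)%N ->
    a = p.2 + (if p.1 then m - l.2 else l.2) %[mod m] ->
  dihedral_elt u v p * dihedral_elt u v l = dihedral_elt u v (p.1 (+) l.1, a).
Proof.
case: p l => [b i] [c j] /= um v2 uJv le_j_m aE.
rewrite /dihedral_elt /= -(expg_mod a um) {a}aE (expg_mod _ um) expgD.
rewrite -!mulgA; congr (_ * _); case: b => /=; last by rewrite mul1g.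
rewrite [v ^+ 1]expg1 (_ : u ^+ (m - j) = (u ^+ j)^-1); last first.
  by apply: (mulIg (u ^+ j)); rewrite mulVg -expgD subnK.
have vu : v * u ^+ j = (u ^+ j)^-1 * v.
  by rewrite [RHS]conjgC conjVg conjXg uJv expgVn invgK.
rewrite mulgA vu -mulgA; congr (_ * _).
by case: c; rewrite /= ?mulg1.
Qed.

(** The 2m reduced pairs map onto a set of 2m elements, so the map is injective. *)
Lemma dihedral_elt_inj {gT : finGroupType} (u v : gT) (m : nat) p p' :
    u ^+ m = 1 -> v ^+ 2 = 1 -> #|<[u]> * <[v]>| = m.*2 ->
    (p.2 < m)%N -> (p'.2 < m)%N ->
  dihedral_elt u v p = dihedral_elt u v p' -> p = p'.
Proof.
case: p p' => [b a] [b' a'] /= um v2 oUV lt_a lt_a' eq_elt.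
have m_gt0 : (0 < m)%N by apply: leq_ltn_trans lt_a.
pose f (q : bool * 'I_m) := dihedral_elt u v (q.1, q.2 : nat).
have /imset_injP f_inj : #|f @: [set: bool * 'I_m]| == #|[set: bool * 'I_m]|.
  rewrite eqn_leq leq_imset_card cardsT card_prod card_bool card_ord mul2n -oUV.
  apply: subset_leq_card; apply/subsetP => g.
  case/mulsgP => _ _ /cycleP[i ->] /cycleP[j ->] ->.
  apply/imsetP; exists (odd j, Ordinal (ltn_pmod i m_gt0)) => //.
  by rewrite /f /dihedral_elt /= (expg_mod _ um) -modn2 (expg_mod _ v2).
have := f_inj (b, Ordinal lt_a) (b', Ordinal lt_a').
by rewrite !inE => /(_ isT isT eq_elt)[-> ->].
Qed.

Theorem theorem4p3 (gT : finGroupType) (G : {group gT}) (m : nat) :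
  (0 < m)%N -> ~~ odd m ->
  G \isog Grp (u : v : (u ^+ m = 1, v ^+ 2 = 1, v * u = u ^+ m.-1 * v)) ->
  forall S : {set gT}, S \subset G :\ 1 -> #|S| = (2 * m - 2)%N ->
  has_S_sequencing S.
Proof.
move=> m_gt0 m_even isoG S sSG oS.
have m_gt1 : (1 < m)%N by case: m m_gt0 m_even {isoG oS} => [|[]].
have [u [v [oG [um v2 uJv] GE]]] := dihedral_structure m_gt1 isoG.
pose k := m./2; have mk : m = k.*2 by rewrite /k; lia.
have phi_inj p p' : (p.2 < k.*2)%N -> (p'.2 < k.*2)%N ->
    dihedral_elt u v p = dihedral_elt u v p' -> p = p'.
  by rewrite -mk; apply: dihedral_elt_inj; rewrite // -GE.
(* [N] is the size 2m - 2 of [S], and N + 1 is the length of the cycle. *)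
pose N := (4 * k - 2)%N; have NE : (4 * k - 1 = N.+1)%N by lia.
have ltN i : (i %% N.+1 < 4 * k - 1)%N by rewrite NE ltn_pmod.
apply: (R_sequencing_has_S_sequencing _ G N
  (fun i => dihedral_elt u v (vertex k (i %% N.+1)))
  (fun i => dihedral_elt u v (label k (i %% N.+1)))) => //.
- by rewrite oG; lia.
- move=> i; have [] := vertex_step _ _ (ltN i).
  rewrite NE -addn1 modnDml addn1 => b1 b2.
  rewrite (dihedral_eltM _ _ _ _ _ (vertex k (i.+1 %% N.+1)).2 um v2 uJv).
  + by rewrite -b1 -surjective_pairing.
  + by rewrite mk ltnW // label_bound.
  + by rewrite mk; case: b2 => ->; rewrite ?modnDr.
- move=> i; rewrite !inE GE mem_mulg ?mem_cycle // andbT.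
  apply/eqP => l1; apply: (label_neq0 _ _ (ltN i)).
  apply: phi_inj; rewrite ?label_bound //=; first by lia.
  by rewrite l1 /dihedral_elt mulg1.
- move=> i j /phi_inj; rewrite !vertex_bound // => /(_ isT isT).
  exact: vertex_inj.
- move=> i j /phi_inj; rewrite !label_bound // => /(_ isT isT).
  exact: label_inj.
- by rewrite oS; lia.
Qed.
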